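(* (ZFC) There is a nonmetrizable compact Hausdorff space $K$ such that every closed totally disconnected subspace of $K$ is metrizable. Moreover, there is also such a space $K$ which in addition has a closed subspace $K'\subseteq K$ admitting a continuous surjection onto a nonmetrizable totally disconnected compact space.
   Context: All spaces are Hausdorff. *)

(* Defs.v *)
From Stdlib Require Import Reals List.
Open Scope R_scope.

Record topology (X : Type) : Type := Topology {
  is_open : (X -> Prop) -> Prop;
  open_full : is_open (fun _ => True);
  open_union : forall F : (X -> Prop) -> Prop,
      (forall U, F U -> is_open U) -> is_open (fun x => exists U, F U /\ U x);
  open_inter : forall U V, is_open U -> is_open V -> is_open (fun x => U x /\ V x)
}.
Arguments is_open {X} t U.

Definition is_closed {X : Type} (t : topology X) (C : X -> Prop) : Prop :=
  is_open t (fun x => ~ C x).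

Definition hausdorff {X : Type} (t : topology X) : Prop :=
  forall x y : X, x <> y ->
    exists U V, is_open t U /\ is_open t V /\ U x /\ V y /\
                (forall z, ~ (U z /\ V z)).

Definition compact_space {X : Type} (t : topology X) : Prop :=
  forall F : (X -> Prop) -> Prop,
    (forall U, F U -> is_open t U) ->
    (forall x, exists U, F U /\ U x) ->
    exists l : list (X -> Prop),
      (forall U, In U l -> F U) /\ (forall x, exists U, In U l /\ U x).

Definition is_metric {X : Type} (d : X -> X -> R) : Prop :=
  (forall x y, 0 <= d x y) /\
  (forall x y, d x y = 0 <-> x = y) /\
  (forall x y, d x y = d y x) /\
  (forall x y z, d x z <= d x y + d y z).

Definition metrizable {X : Type} (t : topology X) : Prop :=
  exists d : X -> X -> R, is_metric d /\
    forall U : X -> Prop,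
      is_open t U <->
      (forall x, U x -> exists eps, 0 < eps /\ forall y, d x y < eps -> U y).

Definition connected_set {X : Type} (t : topology X) (S : X -> Prop) : Prop :=
  ~ exists U V, is_open t U /\ is_open t V /\
      (forall x, S x -> U x \/ V x) /\
      (exists x, S x /\ U x) /\ (exists x, S x /\ V x) /\
      (forall x, S x -> ~ (U x /\ V x)).

Definition totally_disconnected {X : Type} (t : topology X) : Prop :=
  forall S : X -> Prop, connected_set t S ->
    forall x y, S x -> S y -> x = y.

Definition continuous_map {X Y : Type} (tX : topology X) (tY : topology Y)
  (f : X -> Y) : Prop :=
  forall V, is_open tY V -> is_open tX (fun x => V (f x)).

Definition surjective {X Y : Type} (f : X -> Y) : Prop :=
  forall y, exists x, f x = y.

Definition subspace_open {X : Type} (t : topology X) (A : X -> Prop)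
  (W : {x : X | A x} -> Prop) : Prop :=
  exists U, is_open t U /\ forall p, W p <-> U (proj1_sig p).

Lemma subspace_open_full {X : Type} (t : topology X) (A : X -> Prop) :
  subspace_open t A (fun _ => True).
Proof. exists (fun _ => True); split; [apply open_full | tauto]. Qed.

Lemma subspace_open_union {X : Type} (t : topology X) (A : X -> Prop)
  (F : ({x : X | A x} -> Prop) -> Prop) :
  (forall W, F W -> subspace_open t A W) ->
  subspace_open t A (fun p => exists W, F W /\ W p).
Proof.
  intros H.
  exists (fun x => exists U, (is_open t U /\ exists W, F W /\
             forall p, W p <-> U (proj1_sig p)) /\ U x).
  split.
  - apply open_union. intros U [HU _]. exact HU.
  - intros p; split.
    + intros [W [HW Wp]]. destruct (H W HW) as [U [HU HUW]].
      exists U. split; [split; [exact HU | exists W; split; assumption] |].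
      apply HUW; exact Wp.
    + intros [U [[HU [W [HW HUW]]] Up]]. exists W; split; [exact HW|].
      apply HUW; exact Up.
Qed.

Lemma subspace_open_inter {X : Type} (t : topology X) (A : X -> Prop)
  (W1 W2 : {x : X | A x} -> Prop) :
  subspace_open t A W1 -> subspace_open t A W2 ->
  subspace_open t A (fun p => W1 p /\ W2 p).
Proof.
  intros [U1 [H1 E1]] [U2 [H2 E2]].
  exists (fun x => U1 x /\ U2 x); split; [apply open_inter; assumption|].
  intros p; rewrite E1, E2; tauto.
Qed.

Definition subspace {X : Type} (t : topology X) (A : X -> Prop)
  : topology {x : X | A x} :=
  @Topology {x : X | A x} (subspace_open t A) (subspace_open_full t A)
           (subspace_open_union t A) (subspace_open_inter t A).

(* Main.v *)
Require Import Defs.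
From Stdlib Require Import Reals List Lra Lia Classical ClassicalEpsilon.
From Stdlib Require Import FunctionalExtensionality PropExtensionality Wellfounded.
From Stdlib Require Cantor.
From mathcomp Require eqtype boolp wochoice.

(** Replace every point [x] of the Cantor set by the fibre [T = [0,1] ∪ {2}],
    letting the fibres over [y] converge, as [y] tends to [x], to the point
    [f_x(y)] of [[0,1]] in the fibre of [x]; here [f_x(y) = phi_x(k)] depends
    only on the first place [k] where [x] and [y] differ.  A Bernstein-type
    transfinite choice yields functions [phi_x] such that every uncountable
    subset [Y] of the Cantor set has a point [x] at which [f_x], restricted to
    [Y], oscillates through all of [[0,1]].  Hence a closed set with uncountable
    projection contains a whole interval [{x} × [0,1]], while a closed set with
    countable projection is metrizable because countably many functions separate
    its points.  The uncountably many isolated points [(x,2)] destroy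
    metrizability, and collapsing each interval maps the space onto the
    Alexandroff duplicate of the Cantor set. *)

(** * Choice, well-orderings and transfinite selection *)

Definition injective {X Y : Type} (f : X -> Y) : Prop :=
  forall x y, f x = f y -> x = y.

Lemma choice_rel {X Y : Type} (P : X -> Y -> Prop) :
  (forall x, exists y, P x y) -> exists f : X -> Y, forall x, P x (f x).
Proof.
  intros H.
  exists (fun x => proj1_sig (constructive_indefinite_description _ (H x))).
  intros x. exact (proj2_sig (constructive_indefinite_description _ (H x))).
Qed.

Lemma sig_eq {X : Type} {P : X -> Prop} (p q : {x : X | P x}) :
  proj1_sig p = proj1_sig q -> p = q.
Proof.
  destruct p as [x hx], q as [y hy]; simpl; intros ->.
  f_equal. apply proof_irrelevance.
Qed.

Lemma well_ordering (X : Type) :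
  exists lt : X -> X -> Prop, well_founded lt /\
    forall a b, lt a b \/ a = b \/ lt b a.
Proof.
  destruct (wochoice.well_ordering_principle
    (eqtype.Equality.Pack (eqtype.Equality.Class (boolp.gen_eqMixin X))))
    as [r wo]; simpl in r.
  assert (low : forall A : X -> Prop, (exists x, A x) ->
            exists z, A z /\ forall x, A x -> r z x = true).
  { intros A [x Ax].
    destruct (wo (fun y => boolp.asbool (A y))) as [z [[Az zmin] _]].
    - exists x. apply boolp.asboolT, Ax.
    - exists z; split; [apply boolp.asboolW, Az|].
      intros y Ay. apply zmin. apply boolp.asboolT, Ay. }
  (* Negating the reversed relation gives the strict order; a least non-accessible point would have
     only accessible predecessors. *)
  exists (fun a b => r b a = false). split.
  - intros a. apply NNPP; intros na.
    destruct (low (fun a => ~ Acc (fun a b => r b a = false) a)) as [z [nz zmin]].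
    { exists a; exact na. }
    apply nz; constructor; intros y ry. apply NNPP; intros ny.
    rewrite (zmin y ny) in ry; discriminate.
  - intros a b.
    destruct (r a b) eqn:ab; [|tauto]. destruct (r b a) eqn:ba; [|tauto].
    right; left.
    assert (refl : forall x, r x x = true).
    { intros x. destruct (low (eq x)) as [z [<- h]]; [exists x; auto|]. auto. }
    (* Antisymmetry comes from uniqueness of minima: both [a] and [b] are least in the set of these
       two points. *)
    destruct (wo (fun y => boolp.asbool (y = a \/ y = b))) as [z [_ uz]].
    { exists a. apply boolp.asboolT; auto. }
    transitivity z; [symmetry|]; apply uz; split;
      try (apply boolp.asboolT; auto); intros y hy; apply boolp.asboolW in hy;
      destruct hy as [->| ->]; rewrite ?refl, ?ab, ?ba; reflexivity.
Qed.

(** If some initial segment receives an injection of [X], take the least [m] whose segment does, by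
    [e], and pull the order back along [e]. A large segment below [j] in the new order would give a
    large one below [e j], which precedes [m]. *)
Lemma initial_well_ordering (X : Type) :
  exists lt : X -> X -> Prop, well_founded lt /\
    (forall a b, lt a b \/ a = b \/ lt b a) /\
    forall i, ~ exists e : X -> X, injective e /\ forall z, lt (e z) i.
Proof.
  destruct (well_ordering X) as [lt [wf tot]].
  set (big := fun i => exists e : X -> X, injective e /\ forall z, lt (e z) i).
  destruct (classic (exists i, big i)) as [[i hi]|no].
  - assert (hm : exists i, big i /\ forall j, lt j i -> ~ big j).
    { revert hi. induction i as [i IH] using (well_founded_ind wf). intros hi.
      destruct (classic (exists j, lt j i /\ big j)) as [[j [ji bj]]|nj];
        [exact (IH j ji bj)|].
      exists i; split; [exact hi|]. intros j ji bj; apply nj; eauto. }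
    destruct hm as [m [[e [einj elt]] mmin]].
    exists (fun a b => lt (e a) (e b)). split; [|split].
    + apply (wf_inverse_image _ _ lt e wf).
    + intros a b. destruct (tot (e a) (e b)) as [h|[h|h]]; auto.
    + intros j [g [ginj glt]]. apply (mmin (e j) (elt j)).
      exists (fun z => e (g z)). split; [|exact glt].
      intros x y h. apply ginj, einj, h.
  - exists lt. split; [exact wf|]. split; [exact tot|]. intros i hi. apply no; exists i; exact hi.
Qed.

(** Transfinite recursion along an order of cardinal type: stage [c] has as many candidates as [X]
    has points, but fewer earlier values, so a fresh candidate remains. *)
Lemma injective_selector {X : Type} (P : X -> X -> Prop) :
  (forall c, exists j : X -> X, injective j /\ forall z, P c (j z)) ->
  exists s : X -> X, injective s /\ forall c, P c (s c).
Proof.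
  intros HP. destruct (initial_well_ordering X) as [lt [wf [tot small]]].
  set (new := fun c (g : forall c', lt c' c -> X) x =>
                P c x /\ forall c' (h : lt c' c), x <> g c' h).
  set (F := fun c (g : forall c', lt c' c -> X) =>
              epsilon (inhabits c) (new c g)).
  set (s := Fix wf (fun _ => X) F).
  assert (sE : forall c, s c = F c (fun c' _ => s c')).
  { intros c. unfold s. apply (Fix_eq wf (fun _ => X) F). intros x f g fg.
    replace g with f; [reflexivity|].
    apply functional_extensionality_dep; intros y.
    apply functional_extensionality_dep; intros p. apply fg. }
  assert (snew : forall c, new c (fun c' _ => s c') (s c)).
  { intros c. rewrite sE. apply epsilon_spec. apply NNPP; intros no.
    destruct (HP c) as [j [jinj jP]].
    (* Without a fresh candidate each [j z] is some earlier [s c'], and sending [z] to [c'] injects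
       [X] into the segment below [c]. *)
    assert (old : forall z, exists c', lt c' c /\ s c' = j z).
    { intros z. apply NNPP; intros nz. apply no. exists (j z). split; [apply jP|].
      intros c' h e. apply nz. eauto. }
    destruct (choice_rel _ old) as [e he].
    apply (small c). exists e. split; [|apply he].
    intros x y exy. apply jinj. rewrite <- (proj2 (he x)), <- (proj2 (he y)), exy.
    reflexivity. }
  exists s. split; [|apply snew].
  intros a b sab. destruct (tot a b) as [h|[h|h]]; [|exact h|].
  - destruct (proj2 (snew b) a h). symmetry; exact sab.
  - destruct (proj2 (snew a) b h). exact sab.
Qed.

(** * The Cantor set, first differences and countable sets *)

Definition cantor : Type := nat -> bool.

Definition agree (n : nat) (x y : cantor) : Prop :=
  forall i, (i < n)%nat -> x i = y i.

Definition first_diff (x y : cantor) (k : nat) : Prop :=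
  agree k x y /\ x k <> y k.

Definition countable {X : Type} (A : X -> Prop) : Prop :=
  exists e : nat -> X, forall x, A x -> exists n, e n = x.

Lemma first_diff_exists (x y : cantor) : x <> y -> exists k, first_diff x y k.
Proof.
  intros ne.
  assert (hk : exists k, x k <> y k).
  { apply NNPP; intros no. apply ne. apply functional_extensionality; intros k.
    apply NNPP; intros h; apply no; eauto. }
  destruct hk as [k hk]. revert hk.
  induction k as [k IH] using (well_founded_ind Nat.lt_wf_0). intros hk.
  destruct (classic (exists i, (i < k)%nat /\ x i <> y i)) as [[i [ik hi]]|no].
  - exact (IH i ik hi).
  - exists k; split; [|exact hk]. intros i ik. apply NNPP; intros h; apply no; eauto.
Qed.

Lemma first_diff_unique (x y : cantor) (k l : nat) :
  first_diff x y k -> first_diff x y l -> k = l.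
Proof.
  intros [ak dk] [al dl].
  destruct (Nat.lt_trichotomy k l) as [h|[h|h]]; [|exact h|].
  - destruct dk; auto.
  - destruct dl; auto.
Qed.

Lemma first_diff_ge (x y : cantor) (k n : nat) :
  first_diff x y k -> agree n x y -> (n <= k)%nat.
Proof.
  intros [_ d] a. destruct (Nat.le_gt_cases n k) as [h|h]; [exact h|].
  destruct (d (a k h)).
Qed.

Lemma countable_union {X : Type} (A : nat -> X -> Prop) :
  (forall n, countable (A n)) -> countable (fun x => exists n, A n x).
Proof.
  intros H. destruct (choice_rel _ H) as [e he].
  exists (fun m => let (n, i) := Cantor.of_nat m in e n i).
  intros x [n hx]. destruct (he n x hx) as [i hi].
  exists (Cantor.to_nat (n, i)). rewrite Cantor.cancel_of_to. exact hi.
Qed.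

Lemma countable_subset {X : Type} (A B : X -> Prop) :
  (forall x, A x -> B x) -> countable B -> countable A.
Proof. intros s [e he]. exists e. intros x hx. apply he, s, hx. Qed.

Lemma countable_or {X : Type} (A B : X -> Prop) :
  countable A -> countable B -> countable (fun x => A x \/ B x).
Proof.
  intros hA hB.
  apply countable_subset with (fun x => exists n, (match n with O => A | _ => B end) x).
  - intros x [h|h]; [exists 0%nat|exists 1%nat]; exact h.
  - apply countable_union. intros [|n]; assumption.
Qed.

Lemma cantor_uncountable : ~ countable (fun _ : cantor => True).
Proof.
  intros [e he]. destruct (he (fun n => negb (e n n)) I) as [n hn].
  assert (h := f_equal (fun x => x n) hn). simpl in h.
  destruct (e n n); discriminate.
Qed.

(* The binary numeral [1 x_0 ... x_(n-1)]; the leading 1 records the length. *)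
Fixpoint node (x : cantor) (n : nat) : nat :=
  match n with
  | O => 1
  | S m => 2 * node x m + Nat.b2n (x m)
  end.

Lemma node_pos (x : cantor) (n : nat) : (1 <= node x n)%nat.
Proof. induction n; simpl; lia. Qed.

Lemma node_inj (x y : cantor) (n m : nat) :
  node x n = node y m -> n = m /\ agree n x y.
Proof.
  revert m; induction n as [|n IH]; intros [|m]; cbn [node]; intros e.
  - split; [reflexivity|]. intros i h; lia.
  - pose proof (node_pos y m); lia.
  - pose proof (node_pos x n); lia.
  - assert (h : node x n = node y m /\ x n = y m).
    { destruct (x n), (y m); cbn [Nat.b2n] in e; split; try reflexivity; lia. }
    destruct h as [h1 h2]. destruct (IH m h1) as [<- a]. split; [reflexivity|].
    intros i hi. destruct (Nat.eq_dec i n) as [->|]; [exact h2|]. apply a; lia.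
Qed.

Lemma node_agree (x y : cantor) (n : nat) : agree n x y -> node x n = node y n.
Proof.
  induction n as [|n IH]; intros a; [reflexivity|]. cbn [node].
  rewrite IH, (a n); [reflexivity| lia |]. intros i hi; apply a; lia.
Qed.

(** * Condensation points of an uncountable subset of the Cantor set *)

Section Condensation.
Variable Y : cantor -> Prop.

Definition big (x : cantor) (n : nat) : Prop :=
  ~ countable (fun y => Y y /\ agree n x y).

(** There are only countably many nodes, and each node in which [Y] is countable contributes
    countably many points. *)
Lemma countable_non_condensation :
  countable (fun y => Y y /\ exists n, ~ big y n).
Proof.
  apply countable_subset with
    (fun y => exists k, Y y /\ exists n, node y n = k /\ ~ big y n).
  { intros y [Yy [n h]]. exists (node y n). eauto. }
  apply countable_union. intros k.
  destruct (classic (exists x n, node x n = k /\ ~ big x n)) as [[x [n [e h]]]|no].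
  - apply NNPP in h. eapply countable_subset; [|exact h].
    intros y [Yy [m [e' _]]]. split; [exact Yy|].
    apply (node_inj x y n m). congruence.
  - exists (fun _ _ => true). intros y [_ [n [e h]]]. destruct no; eauto.
Qed.

(** Inside the node, pick two distinct points all of whose nodes are [big], and cut beyond their
    first difference. *)
Lemma big_split (x : cantor) (n : nat) : big x n ->
  exists x0 x1 m, (n < m)%nat /\ agree n x x0 /\ agree n x x1 /\
    big x0 m /\ big x1 m /\ ~ agree m x0 x1.
Proof.
  intros hb.
  (* The countably many non-condensation points and the single point [z] cannot exhaust an
     uncountable set. *)
  assert (pick : forall z, exists y, agree n x y /\ (forall m, big y m) /\ y <> z).
  { intros z. apply NNPP; intros no. apply hb.
    apply countable_subset with (fun y => (Y y /\ exists n, ~ big y n) \/ y = z).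
    - intros y [Yy a]. destruct (classic (y = z)) as [|ne]; [tauto|]. left.
      split; [exact Yy|]. apply not_all_ex_not. intros all. apply no. eauto.
    - apply countable_or; [apply countable_non_condensation|].
      exists (fun _ => z). intros y ->. exists 0%nat; reflexivity. }
  destruct (pick x) as [x0 [a0 [b0 _]]]. destruct (pick x0) as [x1 [a1 [b1 ne]]].
  destruct (first_diff_exists x1 x0 ne) as [k [_ dk]].
  exists x0, x1, (S (Nat.max k n)).
  split; [lia|]. split; [exact a0|]. split; [exact a1|].
  split; [apply b0|]. split; [apply b1|].
  intros a. apply dk. symmetry. apply a. lia.
Qed.

(* Cantor scheme of nodes in which [Y] is uncountable: its branches are
   condensation points of [Y]. *)
Lemma condensation_injection : ~ countable Y ->
  exists j : cantor -> cantor, injective j /\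
    forall z N, exists k y, (N <= k)%nat /\ Y y /\ first_diff (j z) y k.
Proof.
  intros unc.
  (* [u] bundles two incompatible extensions of a common length, indexed by a bit; nothing is
     demanded when the node [v] is not [big]. *)
  set (children := fun (v : cantor * nat) (u : (bool -> cantor) * nat) =>
    big (fst v) (snd v) ->
    (snd v < snd u)%nat /\
    (forall b, agree (snd v) (fst v) (fst u b) /\ big (fst u b) (snd u)) /\
    ~ agree (snd u) (fst u false) (fst u true)).
  assert (next : exists nx, forall v, children v (nx v)).
  { apply choice_rel. intros [x n]. unfold children; simpl.
    destruct (classic (big x n)) as [h|h].
    - destruct (big_split x n h) as [x0 [x1 [m [nm [a0 [a1 [b0 [b1 d]]]]]]]].
      exists ((fun b : bool => if b then x1 else x0), m). intros _. simpl.
      split; [exact nm|]. split; [|exact d]. intros [|]; split; assumption.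
    - exists (fun _ => x, n). tauto. }
  destruct next as [nx hnx].
  (* [w z n] is the node reached after [n] splittings, with the bits of [z] dictating the turns. *)
  set (w := fun z : cantor => fix w (n : nat) : cantor * nat :=
    match n with
    | O => (fun _ => false, O)
    | S m => let v := nx (w m) in (fst v (z m), snd v)
    end).
  assert (wS : forall z n, w z (S n) = (fst (nx (w z n)) (z n), snd (nx (w z n))))
    by reflexivity.
  assert (wbig : forall z n, big (fst (w z n)) (snd (w z n))).
  { intros z. induction n as [|n IH].
    - intros c. apply unc. eapply countable_subset; [|exact c]. simpl.
      intros y Yy; split; [exact Yy|]. intros i h; lia.
    - rewrite wS; simpl. apply hnx, IH. }
  assert (wlen : forall z n, (n <= snd (w z n))%nat).
  { intros z. induction n as [|n IH]; [lia|]. rewrite wS; cbn [snd].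
    pose proof (proj1 (hnx (w z n) (wbig z n))). lia. }
  assert (wmon : forall z n m, (n <= m)%nat -> (snd (w z n) <= snd (w z m))%nat /\
                   agree (snd (w z n)) (fst (w z n)) (fst (w z m))).
  { intros z n m nm. induction nm as [|m nm [IH1 IH2]].
    - split; [lia|]. intros i _; reflexivity.
    - rewrite wS; cbn [fst snd]. destruct (hnx (w z m) (wbig z m)) as [h1 [h2 _]].
      split; [lia|]. intros i hi. rewrite (IH2 i hi). apply h2. lia. }
  (* After [S i] splittings the node has length at least [S i], so its bit [i] is final. *)
  set (j := fun z i => fst (w z (S i)) i).
  assert (jw : forall z n, agree (snd (w z n)) (fst (w z n)) (j z)).
  { intros z n i hi. unfold j.
    destruct (Nat.le_gt_cases n (S i)) as [h|h].
    - apply (proj2 (wmon z n (S i) h)), hi.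
    - symmetry. apply (proj2 (wmon z (S i) n ltac:(lia))).
      pose proof (wlen z (S i)); lia. }
  exists j. split.
  (* At the first difference of [z] and [z'] the two branches enter incompatible children of one
     node. *)
  - intros z z' e. apply NNPP; intros ne.
    destruct (first_diff_exists z z' ne) as [k [a d]].
    assert (weq : forall n, (n <= k)%nat -> w z n = w z' n).
    { induction n as [|n IH]; intros h; [reflexivity|].
      rewrite !wS, IH, (a n); [reflexivity|lia|lia]. }
    destruct (hnx (w z k) (wbig z k)) as [_ [_ nd]]. apply nd.
    pose proof (jw z (S k)) as q. pose proof (jw z' (S k)) as q'.
    rewrite wS in q, q'. rewrite <- (weq k (le_n k)) in q'. cbn [fst snd] in q, q'.
    intros i hi. specialize (q i hi). specialize (q' i hi).
    rewrite <- e in q'.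
    destruct (z k), (z' k); congruence.
  - intros z N.
    (* The node [w z N] has length at least [N] and lies on the branch [j z], so it is contained in
       the node of length [N] around [j z]. *)
    assert (h : ~ countable (fun y => Y y /\ agree N (j z) y)).
    { intros c. apply (wbig z N). eapply countable_subset; [|exact c].
      intros y [Yy a]; split; [exact Yy|]. intros i hi.
      pose proof (wlen z N) as l.
      rewrite <- (jw z N) by lia. apply a. lia. }
    assert (hy : exists y, (Y y /\ agree N (j z) y) /\ y <> j z).
    { apply NNPP; intros no. apply h. exists (fun _ => j z).
      intros y hy. exists 0%nat. apply NNPP; intros ne. apply no.
      exists y; split; [exact hy|]. congruence. }
    destruct hy as [y [[Yy a] ne]].
    destruct (first_diff_exists (j z) y) as [k hk]; [congruence|].
    exists k, y. split; [|tauto]. exact (first_diff_ge _ _ _ _ hk a).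
Qed.

End Condensation.

(** * Sequences oscillating through the unit interval *)

(** The index codes a fraction together with a dummy number, so every rational of the interval
    recurs at arbitrarily large indices. *)
Lemma tail_dense_sequence :
  exists q : nat -> R, (forall n, 0 <= q n <= 1) /\
    forall t eps N, 0 <= t <= 1 -> 0 < eps ->
      exists n, (N <= n)%nat /\ Rabs (q n - t) < eps.
Proof.
  exists (fun n => let (i, _) := Cantor.of_nat n in
            let (a, b) := Cantor.of_nat i in Rmin 1 (INR a / INR (S b))).
  assert (pos : forall b, 0 < INR (S b)) by (intros; apply lt_0_INR; lia).
  split.
  - intros n. destruct (Cantor.of_nat n) as [i m]. destruct (Cantor.of_nat i) as [a b].
    split; [|apply Rmin_l]. apply Rmin_glb; [lra|].
    apply Rle_mult_inv_pos; [apply pos_INR|apply pos].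
  - intros t eps N ht heps.
    destruct (archimed_cor1 eps heps) as [b [hb b0]].
    destruct b as [|b]; [lia|].
    assert (fl : forall n x, 0 <= x < INR n -> exists a, INR a <= x < INR a + 1).
    { induction n as [|n IH]; intros x hx; [simpl in hx; lra|].
      rewrite S_INR in hx. destruct (Rlt_le_dec x (INR n)) as [h|h].
      - apply IH; lra.
      - exists n; lra. }
    destruct (fl (S (S b)) (t * INR (S b))) as [a ha].
    { rewrite (S_INR (S b)). pose proof (pos b). nra. }
    exists (Cantor.to_nat (Cantor.to_nat (a, b), N)). split.
    { pose proof (Cantor.to_nat_non_decreasing (Cantor.to_nat (a, b)) N); lia. }
    rewrite !Cantor.cancel_of_to.
    set (s := INR (S b)) in *. pose proof (pos b) as sp. fold s in sp.
    assert (e : INR a = INR a / s * s) by (field; lra).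
    set (u := INR a / s) in *.
    assert (es : / s * s = 1) by (field; lra).
    assert (u <= t) by nra. assert (t < u + / s) by nra.
    rewrite Rmin_right by lra. rewrite Rabs_left1; lra.
Qed.

(** Every point of the unit interval is a cluster value of [psi] along [A]. *)
Definition oscillates (A : nat -> Prop) (psi : nat -> R) : Prop :=
  forall t eps N, 0 <= t <= 1 -> 0 < eps ->
    exists k, (N <= k)%nat /\ A k /\ Rabs (psi k - t) < eps.

(** The successive elements of [A] receive the successive terms of a sequence all of whose tails are
    dense. *)
Lemma oscillating_function (A : nat -> Prop) :
  (forall N, exists k, (N <= k)%nat /\ A k) ->
  exists psi : nat -> R, (forall k, 0 <= psi k <= 1) /\ oscillates A psi.
Proof.
  intros inf. destruct tail_dense_sequence as [q [q01 qd]].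
  (* [cnt k] counts the elements of [A] below [k]. As [cnt k <= k], a late term of [q] sits at a
     late place. *)
  set (cnt := fix cnt (k : nat) : nat := match k with
    | O => O
    | S m => if excluded_middle_informative (A m) then S (cnt m) else cnt m end).
  assert (cntS : forall k, cnt (S k) =
    if excluded_middle_informative (A k) then S (cnt k) else cnt k) by reflexivity.
  assert (cle : forall k, (cnt k <= k)%nat).
  { induction k as [|k IH]; [simpl; lia|]. rewrite cntS.
    destruct excluded_middle_informative; lia. }
  assert (hit : forall d k, A (k + d)%nat -> exists l, A l /\ cnt l = cnt k).
  { induction d as [|d IH]; intros k h.
    - rewrite Nat.add_0_r in h. eauto.
    - destruct (classic (A k)) as [|n]; [eauto|].
      destruct (IH (S k)) as [l [Al e]]; [rewrite Nat.add_succ_comm; exact h|].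
      exists l; split; [exact Al|]. rewrite e, cntS.
      destruct excluded_middle_informative; tauto. }
  assert (hit' : forall k, exists l, A l /\ cnt l = cnt k).
  { intros k. destruct (inf k) as [m [km Am]]. apply (hit (m - k)%nat).
    replace (k + (m - k))%nat with m by lia. exact Am. }
  assert (onto : forall m, exists k, A k /\ cnt k = m).
  { induction m as [|m [k [Ak e]]].
    - apply (hit' 0%nat).
    - destruct (hit' (S k)) as [l [Al el]]. exists l; split; [exact Al|].
      rewrite el, cntS. destruct excluded_middle_informative; [congruence|tauto]. }
  exists (fun k => q (cnt k)). split; [intros; apply q01|].
  intros t eps N ht he. destruct (qd t eps N ht he) as [m [Nm hm]].
  destruct (onto m) as [k [Ak e]]. exists k. split; [|split; [exact Ak|]].
  - pose proof (cle k); lia.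
  - rewrite e; exact hm.
Qed.

(* There are only continuum many sets of nodes, hence each uncountable [Y] can
   be given a condensation point of its own, as in Bernstein's construction. *)
Lemma oscillating_family :
  exists phi : cantor -> nat -> R, (forall x k, 0 <= phi x k <= 1) /\
    forall Y : cantor -> Prop, ~ countable Y ->
      exists x, oscillates (fun k => exists y, Y y /\ first_diff x y k) (phi x).
Proof.
  (* The node of length [S k] of [flip x k] consists of the points whose first difference from [x]
     is at [k]. *)
  set (flip := fun (x : cantor) (k i : nat) =>
                 if Nat.eq_dec i k then negb (x k) else x i).
  assert (flipP : forall x y k, agree (S k) (flip x k) y <-> first_diff x y k).
  { intros x y k. unfold flip. split.
    - intros a. split.
      + intros i hi. rewrite <- (a i) by lia. destruct Nat.eq_dec; [lia|reflexivity].
      + rewrite <- (a k) by lia. destruct Nat.eq_dec; [|lia]. destruct (x k); discriminate.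
    - intros [a d] i hi. destruct Nat.eq_dec as [->|ne].
      + destruct (x k), (y k); tauto.
      + apply a; lia. }
  (* [c] is read as the characteristic function of a set of nodes, so such sets are indexed by the
     Cantor set itself; [A c x] lists the levels at which one of these nodes branches off from
     [x]. *)
  set (A := fun (c x : cantor) (k : nat) => c (node (flip x k) (S k)) = true).
  set (inf := fun c x => forall N, exists k, (N <= k)%nat /\ A c x k).
  (* Stating the requirement as an implication leaves continuum many candidates for every [c]:
     either the premise supplies them or the requirement is void. *)
  destruct (injective_selector (fun c x =>
      (exists j : cantor -> cantor, injective j /\ forall z, inf c (j z)) -> inf c x))
    as [s [sinj hs]].
  { intros c. destruct (classic (exists j : cantor -> cantor, injective j /\
                                   forall z, inf c (j z))) as [[j [ji h]]|no].
    - exists j. auto.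
    - exists (fun z => z). split; [intros x y e; exact e|tauto]. }
  (* As [s] is injective, [x] is assigned to at most one [c] and has a single oscillation condition
     to meet. *)
  assert (ex : forall x, exists psi : nat -> R, (forall k, 0 <= psi k <= 1) /\
     forall c, s c = x -> inf c x -> oscillates (A c x) psi).
  { intros x. destruct (classic (exists c, s c = x /\ inf c x)) as [[c [e h]]|no].
    - destruct (oscillating_function (A c x) h) as [psi [h1 h2]].
      exists psi. split; [exact h1|]. intros c' e' _.
      rewrite (sinj c' c); [exact h2|congruence].
    - exists (fun _ => 0). split; [intros; lra|]. intros c e h; destruct no; eauto. }
  destruct (choice_rel _ ex) as [phi hphi].
  exists phi. split; [intros x; apply (hphi x)|].
  intros Y unc.
  (* [c] codes the nodes that meet [Y]. *)
  set (c := fun k => if excluded_middle_informative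
                          (exists y n, Y y /\ node y n = k) then true else false).
  assert (cA : forall x k, A c x k <-> exists y, Y y /\ first_diff x y k).
  { intros x k. unfold A, c.
    destruct excluded_middle_informative as [[y [n [Yy e]]]|no].
    - split; [|reflexivity]. intros _. exists y. split; [exact Yy|].
      apply flipP. apply (node_inj _ _ (S k) n). congruence.
    - split; [discriminate|]. intros [y [Yy h]]. destruct no.
      exists y, (S k). split; [exact Yy|]. symmetry. apply node_agree, flipP, h. }
  destruct (condensation_injection Y unc) as [j [ji hj]].
  assert (good : inf c (s c)).
  { apply hs. exists j. split; [exact ji|]. intros z N.
    destruct (hj z N) as [k [y [Nk [Yy h]]]]. exists k. split; [exact Nk|].
    apply cA. eauto. }
  exists (s c). intros t eps N ht he.
  destruct (proj2 (hphi (s c)) c eq_refl good t eps N ht he) as [k [Nk [Ak hk]]].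
  exists k. split; [exact Nk|]. split; [apply cA, Ak|exact hk].
Qed.

(** * Compactness, metrizability, and induction over the interval and the Cantor tree *)

Lemma open_local {X : Type} (t : topology X) (U : X -> Prop) :
  (forall x, U x -> exists W, is_open t W /\ W x /\ forall y, W y -> U y) ->
  is_open t U.
Proof.
  intros H.
  replace U with (fun x => exists W, (is_open t W /\ forall y, W y -> U y) /\ W x).
  - apply open_union. tauto.
  - apply functional_extensionality; intros x. apply propositional_extensionality.
    split; [intros [W [[_ s] Wx]]; auto|]. intros Ux. destruct (H x Ux) as [W hW].
    exists W; tauto.
Qed.

Definition finitely_covered {X : Type} (F : (X -> Prop) -> Prop) (B : X -> Prop) :=
  exists l : list (X -> Prop),
    (forall U, In U l -> F U) /\ forall x, B x -> exists U, In U l /\ U x.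

Lemma finitely_covered_union {X : Type} (F : (X -> Prop) -> Prop) (B B1 B2 : X -> Prop) :
  (forall x, B x -> B1 x \/ B2 x) ->
  finitely_covered F B1 -> finitely_covered F B2 -> finitely_covered F B.
Proof.
  intros s [l1 [h1 c1]] [l2 [h2 c2]]. exists (l1 ++ l2). split.
  - intros U hU. apply in_app_or in hU. destruct hU; auto.
  - intros x Bx. destruct (s x Bx) as [h|h].
    + destruct (c1 x h) as [U [a b]]. exists U; split; auto. apply in_or_app; auto.
    + destruct (c2 x h) as [U [a b]]. exists U; split; auto. apply in_or_app; auto.
Qed.

Lemma finitely_covered_subset {X : Type} (F : (X -> Prop) -> Prop) (B B' : X -> Prop) :
  (forall x, B x -> B' x) -> finitely_covered F B' -> finitely_covered F B.
Proof. intros s h. apply (finitely_covered_union F B B' B'); auto. Qed.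

Lemma closed_subspace_compact {X : Type} (t : topology X) (A : X -> Prop) :
  compact_space t -> is_closed t A -> compact_space (subspace t A).
Proof.
  intros ct cA F Fo Fc.
  destruct (ct (fun U => is_open t U /\
      ((exists W, F W /\ forall p, W p <-> U (proj1_sig p)) \/ forall x, U x -> ~ A x)))
    as [l [hl cl]].
  - tauto.
  - intros x. destruct (classic (A x)) as [Ax|nA].
    + destruct (Fc (exist _ x Ax)) as [W [FW Wx]].
      destruct (Fo W FW) as [U [oU e]]. exists U. split; [|exact (proj1 (e _) Wx)].
      split; [exact oU|]. left. eauto.
    + exists (fun x => ~ A x). split; [|exact nA]. split; [exact cA|]. right; auto.
  - assert (R : finitely_covered F (fun p => exists U, In U l /\ U (proj1_sig p))).
    { clear cl. induction l as [|U l IH].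
      - exists nil. split; [contradiction|]. intros p [U [h _]]; contradiction.
      - apply (finitely_covered_union F _ (fun p => U (proj1_sig p))
                 (fun p => exists U, In U l /\ U (proj1_sig p))).
        + intros p [V [[<-|h] Vp]]; [tauto|]. right; eauto.
        + destruct (hl U (or_introl eq_refl)) as [_ [[W [FW e]]|e]].
          * exists (W :: nil). split; [intros V [<-|[]]; exact FW|].
            intros p Up. exists W. split; [left; reflexivity|]. apply e, Up.
          * exists nil. split; [contradiction|]. intros p Up.
            destruct (e _ Up (proj2_sig p)).
        + apply IH. intros V h; apply hl; right; exact h. }
    destruct R as [l' [h1 h2]]. exists l'. split; [exact h1|]. intros p. apply h2, cl.
Qed.

Definition continuous_real {X : Type} (t : topology X) (g : X -> R) : Prop :=
  forall c r, is_open t (fun x => Rabs (g x - c) < r).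

Lemma continuous_real_subspace {X : Type} (t : topology X) (A : X -> Prop) (g : X -> R) :
  continuous_real t g -> continuous_real (subspace t A) (fun p => g (proj1_sig p)).
Proof.
  intros h c r. exists (fun x => Rabs (g x - c) < r). split; [apply h|tauto].
Qed.

Lemma hausdorff_of_separating {X : Type} (t : topology X) :
  (forall x y, x <> y -> exists g, continuous_real t g /\ g x <> g y) -> hausdorff t.
Proof.
  intros H x y ne. destruct (H x y ne) as [g [cg d]].
  set (r := Rabs (g x - g y) / 2).
  assert (rp : 0 < r) by (unfold r; pose proof (Rabs_pos_lt (g x - g y)); lra).
  exists (fun z => Rabs (g z - g x) < r), (fun z => Rabs (g z - g y) < r).
  split; [apply cg|]. split; [apply cg|].
  rewrite !Rminus_diag, Rabs_R0. split; [exact rp|]. split; [exact rp|].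
  intros z [h1 h2]. pose proof (Rabs_triang (g x - g z) (g z - g y)) as tr.
  rewrite (Rabs_minus_sym (g x) (g z)) in tr.
  replace (g x - g z + (g z - g y)) with (g x - g y) in tr by ring.
  unfold r in *; lra.
Qed.

(** The metric is the supremum over [n] of [|g n x - g n y| / 2^n]; its topology is coarser than
    [t], and compactness makes the two agree. *)
Lemma metrizable_of_separating {X : Type} (t : topology X) (g : nat -> X -> R) :
  compact_space t ->
  (forall n, continuous_real t (g n)) ->
  (forall n x, 0 <= g n x <= 2) ->
  (forall x y, x <> y -> exists n, g n x <> g n y) ->
  metrizable t.
Proof.
  intros ct cg bg sep.
  set (T := fun n (x y : X) => Rabs (g n x - g n y) * (/ 2) ^ n).
  assert (p2 : forall n, 0 < (/ 2) ^ n <= 1).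
  { induction n as [|n IH]; simpl; lra. }
  assert (T0 : forall n x y, 0 <= T n x y).
  { intros n x y. pose proof (p2 n). pose proof (Rabs_pos (g n x - g n y)).
    unfold T; nra. }
  assert (gd : forall n x y, Rabs (g n x - g n y) <= 2).
  { intros n x y. pose proof (bg n x). pose proof (bg n y). apply Rabs_le; lra. }
  assert (Tg : forall n x y, T n x y <= Rabs (g n x - g n y)).
  { intros n x y. pose proof (p2 n). pose proof (Rabs_pos (g n x - g n y)).
    unfold T; nra. }
  assert (ex : forall xy : X * X, exists m,
            is_lub (fun r => exists n, r = T n (fst xy) (snd xy)) m).
  { intros [x y]; simpl.
    destruct (completeness (fun r => exists n, r = T n x y)) as [m hm]; [| |eauto].
    - exists 2. intros r [n ->]. pose proof (Tg n x y). pose proof (gd n x y). lra.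
    - exists (T 0%nat x y), 0%nat. reflexivity. }
  destruct (choice_rel _ ex) as [d0 hd].
  set (d := fun x y => d0 (x, y)).
  assert (dge : forall n x y, T n x y <= d x y).
  { intros n x y. apply (proj1 (hd (x, y))). exists n; reflexivity. }
  assert (dle : forall x y m, (forall n, T n x y <= m) -> d x y <= m).
  { intros x y m h. apply (proj2 (hd (x, y))). intros r [n ->]. apply h. }
  exists d. split; [split; [|split; [|split]]|].
  - intros x y. pose proof (dge 0%nat x y). pose proof (T0 0%nat x y). lra.
  - intros x y. split.
    + intros e. apply NNPP; intros ne. destruct (sep x y ne) as [n h].
      pose proof (dge n x y) as q. rewrite e in q. unfold T in q.
      pose proof (p2 n). pose proof (Rabs_pos_lt (g n x - g n y)). nra.
    + intros <-. apply Rle_antisym.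
      * apply dle. intros n. unfold T. rewrite Rminus_diag, Rabs_R0. lra.
      * pose proof (dge 0%nat x x). pose proof (T0 0%nat x x). lra.
  - assert (le : forall x y, d x y <= d y x).
    { intros x y. apply dle. intros n. unfold T. rewrite Rabs_minus_sym. apply dge. }
    intros x y. apply Rle_antisym; apply le.
  - intros x y z. apply dle. intros n.
    pose proof (dge n x y). pose proof (dge n y z). pose proof (p2 n).
    pose proof (Rabs_triang (g n x - g n y) (g n y - g n z)) as tr.
    replace (g n x - g n y + (g n y - g n z)) with (g n x - g n z) in tr by ring.
    unfold T in *; nra.
  - intros U. split.
    + intros oU x Ux.
      (* Cover the space by [U] and by open sets at a positive distance from [x]; the least such
         distance in a finite subcover is a radius that stays inside [U]. *)
      destruct (ct (fun W => is_open t W /\ ((forall z, W z -> U z) \/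
          exists eps, 0 < eps /\ forall z, W z -> eps <= d x z))) as [l [hl cl]].
      { tauto. }
      { intros y. destruct (classic (U y)) as [Uy|nU].
        - exists U. tauto.
        - assert (ne : x <> y) by congruence.
          destruct (sep x y ne) as [n h].
          set (r := Rabs (g n x - g n y) / 2).
          assert (rp : 0 < r)
            by (unfold r; pose proof (Rabs_pos_lt (g n x - g n y)); lra).
          exists (fun z => Rabs (g n z - g n y) < r).
          rewrite Rminus_diag, Rabs_R0. split; [|exact rp].
          split; [apply cg|]. right. exists (r * (/ 2) ^ n).
          pose proof (p2 n). split; [nra|]. intros z hz.
          pose proof (dge n x z) as q. unfold T in q.
          pose proof (Rabs_triang (g n x - g n z) (g n z - g n y)) as tr.
          replace (g n x - g n z + (g n z - g n y)) with (g n x - g n y) in tr by ring.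
          assert (r <= Rabs (g n x - g n z)) by (unfold r in *; lra). nra. }
      assert (R : exists eps, 0 < eps /\
                forall z, (exists W, In W l /\ W z) -> d x z < eps -> U z).
      { clear cl. induction l as [|W l IH].
        - exists 1. split; [lra|]. intros z [W [[] _]].
        - destruct IH as [e1 [p1 h1]]; [intros V h; apply hl; right; exact h|].
          destruct (hl W (or_introl eq_refl)) as [_ [s|[e2 [q2 h2]]]].
          + exists e1. split; [exact p1|]. intros z [V [[<-|h] Vz]] dz; eauto.
          + exists (Rmin e1 e2). split; [apply Rmin_glb_lt; assumption|].
            intros z [V [[<-|h] Vz]] dz.
            * pose proof (h2 z Vz). pose proof (Rmin_r e1 e2). lra.
            * apply h1; [eauto|]. pose proof (Rmin_l e1 e2). lra. }
      destruct R as [eps [ep h]]. exists eps. split; [exact ep|]. auto.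
    + intros H. apply open_local. intros x Ux. destruct (H x Ux) as [eps [ep h]].
      (* Differences are at most 2, so the terms from [N] on stay below [eps / 2] and only finitely
         many functions need control. *)
      destruct (pow_lt_1_zero (/ 2)) with (y := eps / 4) as [N hN];
        [rewrite Rabs_right; lra|lra|].
      assert (oN : forall N, is_open t
                (fun y => forall n, (n < N)%nat -> Rabs (g n y - g n x) < eps / 2)).
      { induction N0 as [|M IH].
        - apply open_local. intros y _. exists (fun _ => True).
          split; [apply open_full|]. split; [exact I|]. intros; lia.
        - apply open_local. intros y hy.
          exists (fun y => (forall n, (n < M)%nat -> Rabs (g n y - g n x) < eps / 2)
                           /\ Rabs (g M y - g M x) < eps / 2).
          split; [apply open_inter; [exact IH|apply cg]|]. split; [split; auto|].
          intros z [h1 h2] n hn.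
          destruct (Nat.eq_dec n M) as [->|]; [exact h2|]. apply h1; lia. }
      exists (fun y => forall n, (n < N)%nat -> Rabs (g n y - g n x) < eps / 2).
      split; [apply oN|]. split.
      * intros n _. rewrite Rminus_diag, Rabs_R0; lra.
      * intros y hy. apply h. apply Rle_lt_trans with (eps / 2); [|lra].
        apply dle. intros n. destruct (Nat.lt_ge_cases n N) as [l|l].
        -- pose proof (hy n l) as q. rewrite Rabs_minus_sym in q.
           pose proof (Tg n x y). lra.
        -- pose proof (hN n l) as q. pose proof (p2 n). rewrite Rabs_right in q by lra.
           pose proof (gd n x y). pose proof (Rabs_pos (g n x - g n y)).
           unfold T. nra.
Qed.

(** Under a metric, finitely many sets with mutual distances below [/ INR (S n)] cover the space,
    and each holds at most one of the points isolated with that radius. Letting [n] vary would make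
    the Cantor set countable. *)
Lemma isolated_nonmetrizable {X : Type} (t : topology X) (i : cantor -> X) :
  compact_space t -> injective i -> (forall x, is_open t (eq (i x))) ->
  ~ metrizable t.
Proof.
  intros ct iinj iso [d [[d0 [deq [dsym dtri]]] dopen]].
  apply cantor_uncountable.
  set (A := fun n x => forall y, d (i x) y < / INR (S n) -> i x = y).
  apply countable_subset with (fun x => exists n, A n x).
  { intros x _. destruct (proj1 (dopen _) (iso x) (i x) eq_refl) as [eps [ep h]].
    destruct (archimed_cor1 eps ep) as [[|n] [hn n0]]; [lia|].
    exists n. intros y hy. apply h. lra. }
  apply countable_union. intros n.
  assert (pn : 0 < / INR (S n)) by (apply Rinv_0_lt_compat, lt_0_INR; lia).
  set (r := / INR (S n)) in *.
  destruct (ct (fun W => is_open t W /\ forall p q, W p -> W q -> d p q < r))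
    as [l [hl cl]].
  { tauto. }
  { intros x. exists (fun y => d x y < r / 2).
    rewrite (proj2 (deq x x) eq_refl). split; [|lra]. split.
    - apply dopen. intros y hy. exists (r / 2 - d x y). split; [lra|].
      intros z hz. pose proof (dtri x y z). lra.
    - intros p q hp hq. pose proof (dtri p x q). rewrite (dsym p x) in *. lra. }
  exists (fun m => epsilon (inhabits (fun _ => true))
                    (fun x => A n x /\ nth m l (fun _ => False) (i x))).
  intros x Ax. destruct (cl (i x)) as [W [hW Wx]].
  destruct (In_nth _ _ (fun _ => False) hW) as [m [_ e]].
  exists m. rewrite e.
  pose proof (epsilon_spec (inhabits (fun _ => true)) (fun x => A n x /\ W (i x))
     (ex_intro _ x (conj Ax Wx))) as [A' W'].
  apply iinj, A', (proj2 (hl W hW)); assumption.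
Qed.

(* Cousin's lemma; it yields both compactness and connectedness of intervals. *)
Lemma interval_induction (Q : R -> R -> Prop) (lo hi : R) : lo <= hi ->
  (forall a b c, lo <= a <= b -> b <= c <= hi -> Q a b -> Q b c -> Q a c) ->
  (forall x, lo <= x <= hi -> exists eps, 0 < eps /\
     forall a b, lo <= a <= x -> x <= b <= hi -> x - eps < a -> b < x + eps -> Q a b) ->
  Q lo hi.
Proof.
  intros lh add loc.
  set (E := fun s => lo <= s <= hi /\ Q lo s).
  assert (E0 : E lo).
  { split; [lra|]. destruct (loc lo) as [e [ep h]]; [lra|]. apply h; lra. }
  destruct (completeness E) as [m [ub lub]].
  { exists hi. intros s [h _]; lra. }
  { exists lo; exact E0. }
  assert (hm : lo <= m <= hi).
  { split; [apply ub, E0|]. apply lub. intros s [h _]; lra. }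
  destruct (loc m hm) as [e [ep h]].
  assert (hs : exists s, E s /\ m - e < s).
  { apply NNPP; intros no. assert (m <= m - e); [|lra].
    apply lub. intros s Es. apply Rnot_lt_le. intros l; apply no; eauto. }
  destruct hs as [s [[s1 s2] s3]].
  assert (sm : s <= m) by (apply ub; split; assumption).
  (* Members of [E] cannot exceed the supremum [m], so this minimum must be [hi]. *)
  assert (Eb : E (Rmin hi (m + e / 2))).
  { pose proof (Rmin_l hi (m + e / 2)). pose proof (Rmin_r hi (m + e / 2)).
    assert (m <= Rmin hi (m + e / 2)) by (apply Rmin_glb; lra).
    split; [lra|]. apply add with s; [lra|lra|exact s2|]. apply h; lra. }
  pose proof (ub _ Eb) as q. unfold Rmin in *.
  destruct (Rle_dec hi (m + e / 2)); [apply Eb|lra].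
Qed.

(** By [up], a bad node has a bad extension one level longer, so a bad root would generate a branch
    with only bad nodes, against the bar. *)
Lemma bar_induction (G : cantor -> nat -> Prop) :
  (forall x y n, agree n x y -> G x n -> G y n) ->
  (forall x n, (forall y, agree n x y -> G y (S n)) -> G x n) ->
  (forall x, exists n, G x n) ->
  forall x, G x 0%nat.
Proof.
  intros inv up bar x0. apply NNPP; intros bad.
  assert (ex : forall v : cantor * nat, exists y, agree (snd v) (fst v) y /\
            (~ G (fst v) (snd v) -> ~ G y (S (snd v)))).
  { intros [x n]; simpl. destruct (classic (G x n)) as [h|h].
    - exists x. split; [intros i _; reflexivity|tauto].
    - apply NNPP; intros no. apply h, up. intros y a. apply NNPP; intros h'.
      apply no. exists y. tauto. }
  destruct (choice_rel _ ex) as [nx hnx].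
  set (w := fix w n := match n with O => x0 | S m => nx (w m, m) end).
  assert (wbad : forall n, ~ G (w n) n).
  { induction n as [|n IH]; [exact bad|]. simpl. apply (hnx (w n, n)), IH. }
  assert (wmon : forall n m, (n <= m)%nat -> agree n (w n) (w m)).
  { intros n m nm. induction nm as [|m nm IH]; [intros i _; reflexivity|].
    intros i hi. rewrite (IH i hi). apply (hnx (w m, m)). simpl; lia. }
  destruct (bar (fun i => w (S i) i)) as [n hn].
  apply (wbad n). apply inv with (2 := hn). intros i hi.
  apply (wmon (S i) n); lia.
Qed.

(** * Resolutions of the Cantor set *)

Section Resolution.

(* Every point [x] of the Cantor set is replaced by a copy of [T]; the points
   over [y <> x] converge to [t] in the fibre of [x] when [y] tends to [x] and
   [phi x k] tends to [t], where [k] is the first place where [x], [y] differ. *)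
Variables (T : R -> Prop) (phi : cantor -> nat -> R).

Definition rpoint : Type := cantor * {t : R | T t}.

(** The last clause leaves [s] free: a neighbourhood takes in whole fibres over nearby base
    points. *)
Definition res_open (U : rpoint -> Prop) : Prop :=
  forall x t, U (x, t) -> exists eps n, 0 < eps /\
    (forall s, Rabs (proj1_sig s - proj1_sig t) < eps -> U (x, s)) /\
    (forall y k s, (n <= k)%nat -> first_diff x y k ->
       Rabs (phi x k - proj1_sig t) < eps -> U (y, s)).

Lemma res_open_full : res_open (fun _ => True).
Proof. intros x t _. exists 1, 0%nat. split; [lra|]. auto. Qed.

Lemma res_open_union (F : (rpoint -> Prop) -> Prop) :
  (forall U, F U -> res_open U) -> res_open (fun p => exists U, F U /\ U p).
Proof.
  intros H x t [U [FU Ut]]. destruct (H U FU x t Ut) as [eps [n [ep [h1 h2]]]].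
  exists eps, n. split; [exact ep|]. split; eauto.
Qed.

Lemma res_open_inter (U V : rpoint -> Prop) :
  res_open U -> res_open V -> res_open (fun p => U p /\ V p).
Proof.
  intros oU oV x t [Ut Vt].
  destruct (oU x t Ut) as [e1 [n1 [p1 [a1 b1]]]].
  destruct (oV x t Vt) as [e2 [n2 [p2 [a2 b2]]]].
  pose proof (Rmin_l e1 e2). pose proof (Rmin_r e1 e2).
  exists (Rmin e1 e2), (Nat.max n1 n2). split; [apply Rmin_glb_lt; assumption|].
  split.
  - intros s hs. split; [apply a1|apply a2]; lra.
  - intros y k s hk hd hs. split; [apply b1 with k|apply b2 with k]; try lia; auto; lra.
Qed.

Definition resolution : topology rpoint :=
  Topology rpoint res_open res_open_full res_open_union res_open_inter.

Definition coord (n : nat) (p : rpoint) : R := if fst p n then 1 else 0.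

(** When [phi] has values in [T], this is the retraction onto the fibre over [a]; off that fibre
    [epsilon] denotes the unique first difference. *)
Definition fibre_coord (a : cantor) (p : rpoint) : R :=
  if excluded_middle_informative (a = fst p) then proj1_sig (snd p)
  else phi a (epsilon (inhabits 0%nat) (first_diff a (fst p))).

Lemma fibre_coord_same (a : cantor) (t : {t : R | T t}) :
  fibre_coord a (a, t) = proj1_sig t.
Proof.
  unfold fibre_coord; simpl. destruct excluded_middle_informative; [reflexivity|tauto].
Qed.

Lemma fibre_coord_diff (a y : cantor) (t : {t : R | T t}) (k : nat) :
  first_diff a y k -> fibre_coord a (y, t) = phi a k.
Proof.
  intros h. unfold fibre_coord; simpl. destruct excluded_middle_informative as [<-|ne].
  - destruct h as [_ h]; tauto.
  - f_equal. apply (first_diff_unique a y); [|exact h].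
    apply epsilon_spec. eauto.
Qed.

Lemma coord_continuous (n : nat) : continuous_real resolution (coord n).
Proof.
  intros c r x t h. exists 1, (S n). split; [lra|]. split.
  - intros s _. exact h.
  - intros y k s hk [a _] _. unfold coord in *; simpl in *.
    rewrite <- (a n) by lia. exact h.
Qed.

(** On the fibre over [a] continuity is built into the topology. Elsewhere the function is locally
    constant, since points near [x] first differ from [a] where [x] does. *)
Lemma fibre_coord_continuous (a : cantor) : continuous_real resolution (fibre_coord a).
Proof.
  intros c r x t h. destruct (classic (a = x)) as [<-|ne].
  - rewrite fibre_coord_same in h.
    exists (r - Rabs (proj1_sig t - c)), 0%nat. split; [lra|].
    assert (tri : forall u, Rabs (u - proj1_sig t) < r - Rabs (proj1_sig t - c) ->
              Rabs (u - c) < r).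
    { intros u hu. pose proof (Rabs_triang (u - proj1_sig t) (proj1_sig t - c)) as q.
      replace (u - proj1_sig t + (proj1_sig t - c)) with (u - c) in q by ring. lra. }
    split.
    + intros s hs. rewrite fibre_coord_same. auto.
    + intros y k s _ hd hs. rewrite (fibre_coord_diff a y s k hd). auto.
  - destruct (first_diff_exists a x ne) as [m hm].
    rewrite (fibre_coord_diff a x t m hm) in h.
    exists 1, (S m). split; [lra|]. split.
    + intros s _. rewrite (fibre_coord_diff a x s m hm). exact h.
    + intros y k s hk [ay _] _. rewrite (fibre_coord_diff a y s m); [exact h|].
      destruct hm as [am dm]. split.
      * intros i hi. rewrite (am i hi). apply ay. lia.
      * rewrite <- (ay m) by lia. exact dm.
Qed.

(** Base points are told apart by countably many bits, points of one fibre by its own coordinate;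
    hence countably many functions suffice over a countable base. *)
Lemma coords_separate (p q : rpoint) : p <> q ->
  (exists n, coord n p <> coord n q) \/ fibre_coord (fst p) p <> fibre_coord (fst p) q.
Proof.
  destruct p as [x t], q as [y s]; simpl. intros ne.
  destruct (classic (x = y)) as [<-|d].
  - right. rewrite !fibre_coord_same. intros e. apply ne. f_equal. apply sig_eq, e.
  - left. destruct (first_diff_exists x y d) as [n [_ h]]. exists n. unfold coord; simpl.
    destruct (x n), (y n); try tauto; lra.
Qed.

Lemma resolution_hausdorff : hausdorff resolution.
Proof.
  apply hausdorff_of_separating. intros p q ne.
  destruct (coords_separate p q ne) as [[n h]|h].
  - exists (coord n). split; [apply coord_continuous|exact h].
  - exists (fibre_coord (fst p)). split; [apply fibre_coord_continuous|exact h].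
Qed.

Hypothesis T_compact : forall eps : R -> R, (forall t, T t -> 0 < eps t) ->
  exists l : list R, (forall t, In t l -> T t) /\
    forall s, T s -> exists t, In t l /\ Rabs (s - t) < eps t.
Hypothesis phi_fibre : forall x k, T (phi x k).

(** Finitely many members of [F] cover the fibre over [x], each with an interval of values; the
    whole fibre over a nearby [y] lies in a member whose interval contains [phi x k]. *)
Lemma resolution_tube (F : (rpoint -> Prop) -> Prop) (x : cantor) :
  (forall U, F U -> is_open resolution U) -> (forall p, exists U, F U /\ U p) ->
  exists n, finitely_covered F (fun p => agree n x (fst p)).
Proof.
  intros Fo Fc.
  assert (ex : forall t, exists v : R * nat * (rpoint -> Prop), T t ->
    let '(eps, n, U) := v in F U /\ 0 < eps /\
    (forall s, Rabs (proj1_sig s - t) < eps -> U (x, s)) /\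
    (forall y k s, (n <= k)%nat -> first_diff x y k ->
       Rabs (phi x k - t) < eps -> U (y, s))).
  { intros t. destruct (classic (T t)) as [h|h].
    - destruct (Fc (x, exist _ t h)) as [U [FU Ut]].
      destruct (Fo U FU x _ Ut) as [eps [n [ep [a b]]]].
      exists (eps, n, U). intros _. auto.
    - exists (1, 0%nat, fun _ => True). tauto. }
  destruct (choice_rel _ ex) as [v hv].
  destruct (T_compact (fun t => fst (fst (v t)))) as [l [lT lc]].
  { intros t Tt. specialize (hv t Tt). destruct (v t) as [[e n] U]. tauto. }
  assert (N : exists N, forall t, In t l -> (snd (fst (v t)) <= N)%nat).
  { clear lT lc. induction l as [|a l [N hN]].
    - exists 0%nat. intros t [].
    - exists (Nat.max N (snd (fst (v a)))). intros t [<-|h]; [lia|].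
      specialize (hN t h); lia. }
  destruct N as [N hN]. exists N, (map (fun t => snd (v t)) l). split.
  - intros U hU. apply in_map_iff in hU. destruct hU as [t [<- ht]].
    specialize (hv t (lT t ht)). destruct (v t) as [[e n] U]. tauto.
  - intros [y s] a; simpl in a. destruct (classic (x = y)) as [<-|ne].
    + destruct (lc (proj1_sig s) (proj2_sig s)) as [t [ht hs]].
      exists (snd (v t)). split; [apply in_map_iff; eauto|].
      specialize (hv t (lT t ht)). destruct (v t) as [[e n] U]. apply hv, hs.
    + destruct (first_diff_exists x y ne) as [k hk].
      destruct (lc (phi x k) (phi_fibre x k)) as [t [ht hs]].
      exists (snd (v t)). split; [apply in_map_iff; eauto|].
      specialize (hv t (lT t ht)). specialize (hN t ht).
      pose proof (first_diff_ge _ _ _ _ hk a).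
      destruct (v t) as [[e n] U]; simpl in *.
      apply hv with k; [lia|exact hk|exact hs].
Qed.

(** Finite covers over the two halves of a node combine to one over the node, and the tube lemma
    gives every branch a finitely covered node; bar induction reaches the root. *)
Lemma resolution_compact : compact_space resolution.
Proof.
  intros F Fo Fc.
  assert (R : finitely_covered F (fun p => agree 0 (fun _ => true) (fst p))).
  { apply (bar_induction (fun x n => finitely_covered F (fun p => agree n x (fst p)))).
    - intros x y n a. apply finitely_covered_subset. intros p h i hi.
      rewrite (a i hi). apply h, hi.
    - intros x n up.
      set (upd := fun (b : bool) i => if Nat.eq_dec i n then b else x i).
      assert (aupd : forall b, agree n x (upd b)).
      { intros b i hi. unfold upd. destruct Nat.eq_dec; [lia|reflexivity]. }
      apply (finitely_covered_union F _ _ _) with (2 := up _ (aupd false))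
                                                  (3 := up _ (aupd true)).
      intros p h.
      assert (H : agree (S n) (upd (fst p n)) (fst p)).
      { intros i hi. unfold upd. destruct Nat.eq_dec as [->|]; [reflexivity|].
        apply h; lia. }
      destruct (fst p n); tauto.
    - intros x. apply resolution_tube; assumption. }
  destruct R as [l [h1 h2]]. exists l. split; [exact h1|].
  intros p. apply h2. intros i hi; lia.
Qed.

Hypothesis T_two : T 2.
Hypothesis T_isolated : forall t, T t -> 0 <= t <= 1 \/ t = 2.
Hypothesis phi_unit : forall x k, 0 <= phi x k <= 1.

Lemma resolution_nonmetrizable : ~ metrizable resolution.
Proof.
  apply (isolated_nonmetrizable resolution (fun x => (x, exist _ 2 T_two))).
  - apply resolution_compact.
  - intros x y e. congruence.
  - intros x y t e. injection e as <- e.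
    assert (et : proj1_sig t = 2) by (rewrite <- e; reflexivity).
    (* The radius is smaller than the gap between 2 and the unit interval, so no other point of the
       fibre and no value of [phi x] comes within it. *)
    exists (1 / 2), 0%nat. split; [lra|]. rewrite et. split.
    + intros s hs. f_equal. apply sig_eq; simpl.
      destruct (T_isolated _ (proj2_sig s)) as [h|h]; [|congruence].
      rewrite Rabs_left in hs; lra.
    + intros y k s _ _ h. pose proof (phi_unit x k). rewrite Rabs_left in h; lra.
Qed.

Lemma countable_base_metrizable (A : rpoint -> Prop) :
  is_closed resolution A -> countable (fun x => exists t, A (x, t)) ->
  metrizable (subspace resolution A).
Proof.
  intros cA [e he].
  (* The code [(0, m)] stands for bit [m], and [(S _, m)] for the fibre coordinate at the base point
     [e m]. *)
  apply (metrizable_of_separating _ (fun n p =>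
    let (i, m) := Cantor.of_nat n in
    match i with
    | O => coord m (proj1_sig p)
    | S _ => fibre_coord (e m) (proj1_sig p)
    end)).
  - apply closed_subspace_compact; [apply resolution_compact|exact cA].
  - intros n. destruct (Cantor.of_nat n) as [[|i] m];
      apply continuous_real_subspace; [apply coord_continuous|apply fibre_coord_continuous].
  - intros n [p Ap]. destruct (Cantor.of_nat n) as [[|i] m]; simpl.
    + unfold coord. destruct (fst p m); lra.
    + unfold fibre_coord. destruct excluded_middle_informative.
      * destruct (T_isolated _ (proj2_sig (snd p))); lra.
      * match goal with |- context [phi ?a ?k] => pose proof (phi_unit a k) end. lra.
  - intros [p Ap] [q Aq] ne.
    assert (pq : p <> q) by (intros h; apply ne, sig_eq, h).
    destruct (coords_separate p q pq) as [[m h]|h].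
    + exists (Cantor.to_nat (0%nat, m)). rewrite Cantor.cancel_of_to. exact h.
    + destruct (he (fst p)) as [m hm].
      { exists (snd p). destruct p; exact Ap. }
      exists (Cantor.to_nat (1%nat, m)). rewrite Cantor.cancel_of_to, hm. exact h.
Qed.

End Resolution.

(** * The resolution whose fibres are an interval with an isolated point *)

Definition pointed_interval (t : R) : Prop := 0 <= t <= 1 \/ t = 2.

Lemma pointed_interval_compact (eps : R -> R) :
  (forall t, pointed_interval t -> 0 < eps t) ->
  exists l : list R, (forall t, In t l -> pointed_interval t) /\
    forall s, pointed_interval s -> exists t, In t l /\ Rabs (s - t) < eps t.
Proof.
  intros ep.
  destruct (interval_induction (fun a b => exists l : list R,
      (forall t, In t l -> 0 <= t <= 1) /\
      forall s, a <= s <= b -> exists t, In t l /\ Rabs (s - t) < eps t) 0 1)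
    as [l [h1 h2]].
  - lra.
  - intros a b c _ _ [l1 [h1 c1]] [l2 [h2 c2]]. exists (l1 ++ l2). split.
    + intros t h. apply in_app_or in h. destruct h; auto.
    + intros s hs. destruct (Rle_dec s b).
      * destruct (c1 s) as [t [ht q]]; [lra|]. exists t; split; [|exact q].
        apply in_or_app; auto.
      * destruct (c2 s) as [t [ht q]]; [lra|]. exists t; split; [|exact q].
        apply in_or_app; auto.
  - intros x hx. exists (eps x). split; [apply ep; left; exact hx|].
    intros a b ha hb h1 h2. exists (x :: nil). split; [intros t [<-|[]]; exact hx|].
    intros s hs. exists x. split; [left; reflexivity|]. apply Rabs_def1; lra.
  - exists (2 :: l). split.
    + intros t [<-|h]; [right; reflexivity|left; auto].
    + intros s [hs| ->].
      * destruct (h2 s hs) as [t [ht q]]. exists t. split; [right; exact ht|exact q].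
      * exists 2. split; [left; reflexivity|]. rewrite Rminus_diag, Rabs_R0.
        apply ep. right; reflexivity.
Qed.

Lemma fibre_connected (phi : cantor -> nat -> R)
  (A : rpoint pointed_interval -> Prop) (x : cantor) :
  (forall t, proj1_sig t <= 1 -> A (x, t)) ->
  connected_set (subspace (resolution pointed_interval phi) A)
    (fun p => fst (proj1_sig p) = x /\ proj1_sig (snd (proj1_sig p)) <= 1).
Proof.
  intros hA [U [V [[U' [oU eU]] [[V' [oV eV]] [cov [[[[x1 t1] A1] [[e1 l1] U1]]
    [[[[x2 t2] A2] [[e2 l2] V2]] dis]]]]]]].
  simpl in e1, l1, e2, l2. subst x1 x2.
  assert (cov' : forall t, proj1_sig t <= 1 -> U' (x, t) \/ V' (x, t)).
  { intros t ht. set (p := exist A (x, t) (hA t ht) : {p | A p}).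
    destruct (cov p) as [h|h]; [split; [reflexivity|exact ht]|left|right].
    - exact (proj1 (eU p) h).
    - exact (proj1 (eV p) h). }
  assert (dis' : forall t, proj1_sig t <= 1 -> U' (x, t) -> V' (x, t) -> False).
  { intros t ht u v. set (p := exist A (x, t) (hA t ht) : {p | A p}).
    apply (dis p); [split; [reflexivity|exact ht]|].
    split; [exact (proj2 (eU p) u)|exact (proj2 (eV p) v)]. }
  (* Interval induction on membership in [U']: near each point one of the open sets [U'], [V']
     contains everything, so membership does not change. *)
  assert (same : forall c, 0 <= c <= 1 ->
     forall h0 hc, U' (x, exist pointed_interval 0 h0) <-> U' (x, exist pointed_interval c hc)).
  { intros c hc.
    apply (interval_induction (fun a b => forall ha hb,
      U' (x, exist pointed_interval a ha) <-> U' (x, exist pointed_interval b hb)) 0 c).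
    - lra.
    - intros a b d h1 h2 q1 q2 ha hd.
      assert (hb : pointed_interval b) by (left; lra).
      rewrite (q1 ha hb). apply q2.
    - intros s hs. assert (Ts : pointed_interval s) by (left; lra).
      destruct (cov' (exist _ s Ts)) as [h|h]; [simpl; lra| |].
      + destruct (oU x _ h) as [eps [n [ep [near _]]]]. exists eps. split; [exact ep|].
        intros a b h1 h2 h3 h4 ha hb.
        split; intros _; apply near; simpl; apply Rabs_def1; lra.
      + destruct (oV x _ h) as [eps [n [ep [near _]]]]. exists eps. split; [exact ep|].
        intros a b h1 h2 h3 h4 ha hb.
        split; intros u; exfalso; eapply dis'; try exact u; simpl; try lra;
          apply near; simpl; apply Rabs_def1; lra. }
  assert (h0 : pointed_interval 0) by (left; lra).
  assert (unit : forall t : {t | pointed_interval t}, proj1_sig t <= 1 -> 0 <= proj1_sig t <= 1).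
  { intros [t [h|h]]; simpl; lra. }
  apply (dis' t2 l2).
  - pose proof (unit t1 l1) as u1. pose proof (unit t2 l2) as u2.
    apply (eU (exist A _ A1)) in U1. simpl in U1.
    destruct t1 as [r1 q1], t2 as [r2 q2]; simpl in *.
    apply (same r2 u2 h0 q2), (same r1 u1 h0 q1), U1.
  - exact (proj1 (eV (exist A _ A2)) V2).
Qed.

Lemma closed_totally_disconnected_metrizable (phi : cantor -> nat -> R) :
  (forall x k, 0 <= phi x k <= 1) ->
  (forall Y : cantor -> Prop, ~ countable Y ->
     exists x, oscillates (fun k => exists y, Y y /\ first_diff x y k) (phi x)) ->
  forall A, is_closed (resolution pointed_interval phi) A ->
    totally_disconnected (subspace (resolution pointed_interval phi) A) ->
    metrizable (subspace (resolution pointed_interval phi) A).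
Proof.
  intros phi01 osc A cA td.
  destruct (classic (countable (fun x => exists t, A (x, t)))) as [h|unc].
  { apply countable_base_metrizable; auto.
    - apply pointed_interval_compact.
    - intros x k; left; apply phi01. }
  exfalso. destruct (osc _ unc) as [x hx].
  (* A missing point [(x, t)] has a neighbourhood off [A] that contains the fibre over every [y]
     close to [x] with [phi x k] close to [t]; oscillation finds such a [y] beneath a point of
     [A]. *)
  assert (fib : forall t, proj1_sig t <= 1 -> A (x, t)).
  { intros t ht. apply NNPP; intros nA.
    destruct (cA x t nA) as [eps [n [ep [_ far]]]].
    assert (t01 : 0 <= proj1_sig t <= 1) by (destruct (proj2_sig t); lra).
    destruct (hx (proj1_sig t) eps n t01 ep) as [k [nk [[y [[s As] hd]] hk]]].
    exact (far y k s nk hd hk As). }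
  assert (h0 : pointed_interval 0) by (left; lra).
  assert (h1 : pointed_interval 1) by (left; lra).
  assert (e := td _ (fibre_connected phi A x fib)
     (exist A _ (fib (exist _ 0 h0) Rle_0_1))
     (exist A _ (fib (exist _ 1 h1) (Rle_refl 1)))
     (conj eq_refl Rle_0_1) (conj eq_refl (Rle_refl 1))).
  apply (f_equal (fun p => proj1_sig (snd (proj1_sig p)))) in e. simpl in e. lra.
Qed.

(** * The Alexandroff duplicate and the collapsing map *)

Definition two_points (t : R) : Prop := t = 0 \/ t = 2.

(** With [phi] zero, all nearby fibres converge to [(x, 0)], while the points [(x, 2)] are isolated
    copies. *)
Definition alexandroff_duplicate : topology (rpoint two_points) :=
  resolution two_points (fun _ _ => 0).

Lemma two_points_compact (eps : R -> R) :
  (forall t, two_points t -> 0 < eps t) ->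
  exists l : list R, (forall t, In t l -> two_points t) /\
    forall s, two_points s -> exists t, In t l /\ Rabs (s - t) < eps t.
Proof.
  intros ep. exists (0 :: 2 :: nil). split.
  - intros t [<-|[<-|[]]]; [left|right]; reflexivity.
  - intros s hs. exists s. split; [destruct hs as [-> | ->]; simpl; auto|].
    rewrite Rminus_diag, Rabs_R0. auto.
Qed.

Lemma duplicate_compact : compact_space alexandroff_duplicate.
Proof.
  apply resolution_compact; [apply two_points_compact|]. intros; left; reflexivity.
Qed.

Lemma duplicate_nonmetrizable : ~ metrizable alexandroff_duplicate.
Proof.
  apply resolution_nonmetrizable.
  - apply two_points_compact.
  - intros; left; reflexivity.
  - right; reflexivity.
  - intros t [->| ->]; [left; lra|right; reflexivity].
  - intros; lra.
Qed.

(** Each separating coordinate takes only two values here, so it disconnects any set containing two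
    points that it tells apart. *)
Lemma duplicate_totally_disconnected : totally_disconnected alexandroff_duplicate.
Proof.
  intros S con p q Sp Sq. apply NNPP; intros ne.
  assert (sep : exists g v, continuous_real alexandroff_duplicate g /\ g p <> g q /\
            1 <= v <= 2 /\ forall z, g z = 0 \/ g z = v).
  { destruct (coords_separate two_points (fun _ _ => 0) p q ne) as [[n h]|h].
    - exists (coord two_points n), 1. split; [apply coord_continuous|].
      split; [exact h|]. split; [lra|]. intros z. unfold coord.
      destruct (fst z n); auto.
    - exists (fibre_coord two_points (fun _ _ => 0) (fst p)), 2.
      split; [apply fibre_coord_continuous|]. split; [exact h|]. split; [lra|].
      intros z. unfold fibre_coord.
      destruct excluded_middle_informative; [exact (proj2_sig (snd z))|auto]. }
  destruct sep as [g [v [cg [gpq [hv val]]]]].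
  (* The second interval, from [1 / 2] to [5 / 2], contains every admissible [v] and misses the
     first. *)
  apply con. exists (fun z => Rabs (g z - 0) < 1 / 2), (fun z => Rabs (g z - 3 / 2) < 1).
  assert (zero : forall z, g z = 0 -> Rabs (g z - 0) < 1 / 2)
    by (intros z h; rewrite h; apply Rabs_def1; lra).
  assert (large : forall z, g z = v -> Rabs (g z - 3 / 2) < 1)
    by (intros z h; rewrite h; apply Rabs_def1; lra).
  split; [apply cg|]. split; [apply cg|]. split; [|split; [|split]].
  - intros z _. destruct (val z); auto.
  - destruct (val p); [eauto|]. destruct (val q); [eauto|congruence].
  - destruct (val p); [|eauto]. destruct (val q); [congruence|eauto].
  - intros z _ [h1 h2]. apply Rabs_def2 in h1. apply Rabs_def2 in h2. lra.
Qed.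

Definition collapse (p : rpoint pointed_interval) : rpoint two_points :=
  (fst p, if Rle_dec (proj1_sig (snd p)) 1
          then exist two_points 0 (or_introl eq_refl)
          else exist two_points 2 (or_intror eq_refl)).

Lemma collapse_surjective (q : rpoint two_points) : exists p, collapse p = q.
Proof.
  destruct q as [x [t h]].
  assert (ht : pointed_interval t)
    by (destruct h as [->| ->]; [left; lra|right; reflexivity]).
  exists (x, exist _ t ht). unfold collapse; simpl. f_equal. apply sig_eq.
  destruct (Rle_dec t 1); simpl; destruct h; lra.
Qed.

Lemma collapse_continuous (phi : cantor -> nat -> R) :
  (forall x k, 0 <= phi x k <= 1) ->
  continuous_map (resolution pointed_interval phi) alexandroff_duplicate collapse.
Proof.
  intros phi01 V oV x t h. unfold collapse in h; cbn [fst snd] in h.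
  assert (near : forall s : {t | pointed_interval t},
            Rabs (proj1_sig s - proj1_sig t) < 1 / 2 ->
            (proj1_sig s <= 1 <-> proj1_sig t <= 1)).
  { intros s hs. apply Rabs_def2 in hs.
    destruct (proj2_sig s), (proj2_sig t); lra. }
  destruct (oV x _ h) as [eps [n [ep [_ far]]]].
  (* By [near] this radius stays on one side of the gap. If [t] is 2, no value of [phi x] is this
     close; otherwise the image is [(x, 0)], to which all nearby fibres of the duplicate
     converge. *)
  exists (1 / 2), n. split; [lra|]. split.
  - intros s hs. specialize (near s hs). unfold collapse; cbn [fst snd].
    destruct (Rle_dec (proj1_sig s) 1), (Rle_dec (proj1_sig t) 1); tauto.
  - intros y k s nk hd hs. apply far with k; [exact nk|exact hd|].
    pose proof (phi01 x k). apply Rabs_def2 in hs.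
    destruct (Rle_dec (proj1_sig t) 1) as [l|l]; simpl.
    + rewrite Rminus_diag, Rabs_R0. exact ep.
    + destruct (proj2_sig t); lra.
Qed.

Theorem theorem3p2 :
  (exists (K : Type) (tK : topology K),
      compact_space tK /\ hausdorff tK /\ ~ metrizable tK /\
      (forall A : K -> Prop, is_closed tK A ->
         totally_disconnected (subspace tK A) -> metrizable (subspace tK A)))
  /\
  (exists (K : Type) (tK : topology K),
      compact_space tK /\ hausdorff tK /\ ~ metrizable tK /\
      (forall A : K -> Prop, is_closed tK A ->
         totally_disconnected (subspace tK A) -> metrizable (subspace tK A)) /\
      exists (K' : K -> Prop), is_closed tK K' /\
        exists (L : Type) (tL : topology L) (f : {x : K | K' x} -> L),
          compact_space tL /\ hausdorff tL /\ totally_disconnected tL /\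
          ~ metrizable tL /\
          continuous_map (subspace tK K') tL f /\ surjective f).
Proof.
  destruct oscillating_family as [phi [phi01 osc]].
  set (tK := resolution pointed_interval phi).
  assert (phiT : forall x k, pointed_interval (phi x k)) by (intros; left; apply phi01).
  assert (K1 : compact_space tK)
    by (apply resolution_compact; [apply pointed_interval_compact|exact phiT]).
  assert (K2 : hausdorff tK) by apply resolution_hausdorff.
  assert (K3 : ~ metrizable tK).
  { apply resolution_nonmetrizable; auto.
    - apply pointed_interval_compact.
    - right; reflexivity. }
  assert (K4 := closed_totally_disconnected_metrizable phi phi01 osc).
  (* One space serves both claims; in the second, [K'] is the whole space. *)
  split; exists (rpoint pointed_interval), tK;
    (split; [exact K1|split; [exact K2|split; [exact K3|]]]); [exact K4|].
  split; [exact K4|].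
  exists (fun _ => True). split.
  { intros x t h. destruct (h I). }
  exists (rpoint two_points), alexandroff_duplicate, (fun p => collapse (proj1_sig p)).
  split; [apply duplicate_compact|]. split; [apply resolution_hausdorff|].
  split; [apply duplicate_totally_disconnected|].
  split; [apply duplicate_nonmetrizable|]. split.
  - intros V oV. exists (fun p => V (collapse p)).
    split; [apply collapse_continuous; assumption|tauto].
  - intros q. destruct (collapse_surjective q) as [p hp].
    exists (exist _ p I). exact hp.
Qed.
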